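(* The group $2V$ is countably infinite and contains all finite groups (that is, every finite group is isomorphic to a subgroup of $2V$).
   Context: Let $C\subset I=[0,1]$ be the standard middle-thirds Cantor set. A pattern is a finite set of rectangles in $I^2$ obtained from the trivial pattern $\{I^2\}$ by finitely many steps, where each step removes one rectangle $R$ of the pattern and replaces it by the two congruent rectangles obtained by dividing $R$ exactly in half by either a vertical or a horizontal line. Each rectangle $R$ occurring in a pattern corresponds to a closed and open subset $A(R)$ of $C\times C$, defined inductively: $A(I^2)=C\times C$; if $R$ is divided vertically into left half $R'$ and right half $R''$, then $A(R')$ and $A(R'')$ are the left third and right third of $A(R)$; if $R$ is divided horizontally into bottom half $R'$ and top half $R''$, then $A(R')$ and $A(R'')$ are the bottom third and top third of $A(R)$. (Here the thirds of $A(R)$ are its intersections with the corresponding closed thirds of the smallest closed rectangle containing $A(R)$.) The sets $A(R)$, for $R$ in a pattern, partition $C\times C$. A numbered pattern is a pattern with $n$ rectangles together with a bijection between $\{0,1,\ldots,n-1\}$ and its rectangles. If $P_1$ and $P_2$ are numbered patterns with the same number $n$ of rectangles, with rectangles $R_0,\ldots,R_{n-1}$ and $T_0,\ldots,T_{n-1}$ respectively (subscripts giving the numbering), then $h(P_1,P_2)$ is the self homeomorphism of $C\times C$ that takes each $A(R_i)$ onto $A(T_i)$ by the restriction of the unique map of $\mathbf{R}^2$ of the form $(x,y)\mapsto(a+3^jx,\,b+3^ky)$ with $a,b\in\mathbf{R}$, $j,k\in\mathbf{Z}$ carrying $A(R_i)$ onto $A(T_i)$. The group $2V$ is the set of all homeomorphisms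 $h(P_1,P_2)$ over all pairs of numbered patterns with the same number of rectangles, under composition. *)

(* Defs.v *)
From HB Require Import structures.
From mathcomp Require Import all_boot all_order all_fingroup all_algebra.
From mathcomp Require Import all_classical all_reals all_analysis.

Set Implicit Arguments.
Unset Strict Implicit.
Unset Printing Implicit Defensive.

Import Order.TTheory GRing.Theory Num.Theory.
Import numFieldNormedType.Exports.

Local Open Scope classical_set_scope.
Local Open Scope ring_scope.

Record self_homeo (T : topologicalType) := SelfHomeo {
  homeo_fun :> T -> T ;
  homeo_inv : T -> T ;
  homeo_funK : cancel homeo_fun homeo_inv ;
  homeo_invK : cancel homeo_inv homeo_fun ;
  homeo_fun_cts : continuous homeo_fun ;
  homeo_inv_cts : continuous homeo_inv }.

Section HomeoGroup.
Variable T : topologicalType.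
Implicit Types f g h : self_homeo T.

Lemma self_homeoP f g : f =1 g -> f = g.
Proof.
case: f g => [f f' fK f'K cf cf'] [g g' gK g'K cg cg'] /= /funext efg.
subst g; have e' : f' = g' by apply/funext => x; rewrite -[x in LHS]g'K fK.
by subst g'; congr SelfHomeo; exact: Prop_irrelevance.
Qed.

HB.instance Definition _ := gen_eqMixin (self_homeo T).
HB.instance Definition _ := gen_choiceMixin (self_homeo T).

Definition homeo_one : self_homeo T :=
  @SelfHomeo T id id (fun=> erefl) (fun=> erefl)
    (fun=> cvg_id) (fun=> cvg_id).

Definition homeo_mul f g : self_homeo T :=
  @SelfHomeo T (f \o g) (homeo_inv g \o homeo_inv f)
    (can_comp (@homeo_funK T f) (@homeo_funK T g))
    (can_comp (@homeo_invK T g) (@homeo_invK T f))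
    (fun x => continuous_comp (@homeo_fun_cts T g x) (@homeo_fun_cts T f _))
    (fun x => continuous_comp (@homeo_inv_cts T f x) (@homeo_inv_cts T g _)).

Definition homeo_inverse f : self_homeo T :=
  SelfHomeo (@homeo_invK T f) (@homeo_funK T f)
    (@homeo_inv_cts T f) (@homeo_fun_cts T f).

Lemma homeo_mulA : associative homeo_mul.
Proof. by move=> f g h; exact: self_homeoP. Qed.

Lemma homeo_mul1g : left_id homeo_one homeo_mul.
Proof. by move=> f; exact: self_homeoP. Qed.

Lemma homeo_mulg1 : right_id homeo_one homeo_mul.
Proof. by move=> f; exact: self_homeoP. Qed.

Lemma homeo_mulVg : left_inverse homeo_one homeo_inverse homeo_mul.
Proof. by move=> f; apply: self_homeoP; exact: homeo_funK. Qed.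

Lemma homeo_mulgV : right_inverse homeo_one homeo_inverse homeo_mul.
Proof. by move=> f; apply: self_homeoP; exact: homeo_invK. Qed.

HB.instance Definition _ := isGroup.Build (self_homeo T)
  homeo_mulA homeo_mul1g homeo_mulg1 homeo_mulVg homeo_mulgV.

End HomeoGroup.

Section TwoV.
Variable R : realType.

Definition cantor_step (X : set R) : set R :=
  [set x / 3 | x in X] `|` [set (x + 2) / 3 | x in X].

Definition cantor_set : set R := \bigcap_n iter n cantor_step `[0, 1]%classic.

Definition cantor_square : set (R * R) := cantor_set `*` cantor_set.

(* The rectangle [xmin, xmax] x [ymin, ymax]. *)
Record rect := Rect { xmin : R ; xmax : R ; ymin : R ; ymax : R }.

Definition rect_set (r : rect) : set (R * R) :=
  `[xmin r, xmax r]%classic `*` `[ymin r, ymax r]%classic.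

Definition unit_square : rect := Rect 0 1 0 1.

Definition left_half (r : rect) : rect :=
  Rect (xmin r) ((xmin r + xmax r) / 2) (ymin r) (ymax r).
Definition right_half (r : rect) : rect :=
  Rect ((xmin r + xmax r) / 2) (xmax r) (ymin r) (ymax r).
Definition bottom_half (r : rect) : rect :=
  Rect (xmin r) (xmax r) (ymin r) ((ymin r + ymax r) / 2).
Definition top_half (r : rect) : rect :=
  Rect (xmin r) (xmax r) ((ymin r + ymax r) / 2) (ymax r).

Inductive is_pattern : set rect -> Prop :=
| pattern_unit : is_pattern [set unit_square]
| pattern_vertical P r : is_pattern P -> P r ->
    is_pattern ((P `\ r) `|` [set left_half r; right_half r])
| pattern_horizontal P r : is_pattern P -> P r ->
    is_pattern ((P `\ r) `|` [set bottom_half r; top_half r]).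

Record numbered_pattern (n : nat) := NumberedPattern {
  np_set : set rect ;
  np_rect :> 'I_n -> rect ;
  np_is_pattern : is_pattern np_set ;
  np_bij : set_bij [set: 'I_n] np_set np_rect }.

Definition left_third (r : rect) : rect :=
  Rect (xmin r) (xmin r + (xmax r - xmin r) / 3) (ymin r) (ymax r).
Definition right_third (r : rect) : rect :=
  Rect (xmax r - (xmax r - xmin r) / 3) (xmax r) (ymin r) (ymax r).
Definition bottom_third (r : rect) : rect :=
  Rect (xmin r) (xmax r) (ymin r) (ymin r + (ymax r - ymin r) / 3).
Definition top_third (r : rect) : rect :=
  Rect (xmin r) (xmax r) (ymax r - (ymax r - ymin r) / 3) (ymax r).

(* The smallest closed rectangle containing a nonempty bounded set. *)
Definition hull (S : set (R * R)) : rect :=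
  Rect (inf (fst @` S)) (sup (fst @` S)) (inf (snd @` S)) (sup (snd @` S)).

Inductive is_piece : rect -> set (R * R) -> Prop :=
| piece_unit : is_piece unit_square cantor_square
| piece_left r S : is_piece r S ->
    is_piece (left_half r) (S `&` rect_set (left_third (hull S)))
| piece_right r S : is_piece r S ->
    is_piece (right_half r) (S `&` rect_set (right_third (hull S)))
| piece_bottom r S : is_piece r S ->
    is_piece (bottom_half r) (S `&` rect_set (bottom_third (hull S)))
| piece_top r S : is_piece r S ->
    is_piece (top_half r) (S `&` rect_set (top_third (hull S))).

(* The set A(r).  A rectangle occurring in a pattern is related by [is_piece]
   to exactly one set, since the order in which vertical and horizontal
   divisions are made does not matter; [get] selects that set. *)
Definition piece (r : rect) : set (R * R) := get (is_piece r).

Definition triadic_affine (a b : R) (j k : int) (z : R * R) : R * R :=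
  (a + 3 ^ j * z.1, b + 3 ^ k * z.2).

(* [f] is h(P1, P2).  As the pieces of P1 partition the Cantor square, this
   determines [f]. *)
Definition is_pattern_homeo n (P1 P2 : numbered_pattern n)
    (f : self_homeo cantor_square) : Prop :=
  forall i : 'I_n, exists (a b : R) (j k : int),
    triadic_affine a b j k @` piece (P1 i) = piece (P2 i) /\
    forall z : cantor_square, piece (P1 i) (\val z) ->
      \val (f z) = triadic_affine a b j k (\val z).

Definition twoV : set (self_homeo cantor_square) :=
  [set f | exists n (P1 P2 : numbered_pattern n), is_pattern_homeo P1 P2 f].

End TwoV.

Arguments cantor_set R _ : clear implicits.
Arguments cantor_square R _ : clear implicits.
Arguments twoV R _ : clear implicits.

(* Main.v *)
Require Import Defs.
From HB Require Import structures.
From mathcomp Require Import all_boot all_order all_fingroup all_algebra.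
From mathcomp Require Import all_classical all_reals all_analysis.
From mathcomp Require Import ring lra.

(** A rectangle of a pattern is named by a cell: a pair of binary words, the
    first listing the left/right choices and the second the bottom/top choices
    made on the way to it.  Reading the digits in base 2 gives the rectangle,
    reading them in base 3 gives the piece of the Cantor square that goes with
    it ([piece_cell]), and an increasing affine map carrying one piece onto
    another must transport ternary expansions: it strips one pair of words and
    puts the other in its place ([carriesP]).  So a member of 2V is a prefix
    replacement: [carries f c d] says that [f] replaces the prefix [c] by [d].

    Everything rests on a description of 2V in which patterns no longer occur:
    [f] is in 2V iff for some [N] it carries every cell of the grid of all pairs
    of words of length [N] to some cell ([twoVP]).  Given two patterns, every
    cell of a fine enough grid lies in a cell of the first one.  Conversely, the
    grid is a pattern, and its images under [f] partition the Cantor square into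
    cells; what must be shown is that in dimension 2 such a partition is always
    a pattern ([exact_cover_cell_pattern]).  The reason is that two cells
    [([::], v)] and [(u, [::])], one of full width and one of full height, always
    meet.  Hence in a nontrivial partition either no cell has full width or no
    cell has full height, so that one of the two medians cuts no cell, and both
    sides are smaller partitions.

    The three claims then need no further geometry.  Prefix replacements at
    depths [N] and [M] compose to one at depth [M + N]; the image cells of
    a grid have bounded depth, so that a deeper grid refines them, which deals
    with inverses.  An element is determined by its finite list of replaced
    prefixes, whence countability.  Finally a permutation of the words of length
    [N] acts on the Cantor square by recoding the first [N] digits of the first
    coordinate; applied to the left translations of a finite group [gT], with
    the elements coded by words of length [#|gT|], this embeds [gT] into 2V
    ([finite_group_embeds]).  Embedding cyclic groups of every order shows that
    2V is infinite. *)

Set Implicit Arguments.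
Unset Strict Implicit.
Unset Printing Implicit Defensive.

Import Order.TTheory GRing.Theory Num.Theory.
Import numFieldNormedType.Exports.
Local Open Scope classical_set_scope.

(** * Cells and their partitions *)

(** The digits of the abscissa, then those of the ordinate, most significant
    digit first. *)
Definition cell := (seq bool * seq bool)%type.

Definition unit_cell : cell := ([::], [::]).

Definition subcell (c d : cell) : cell := (c.1 ++ d.1, c.2 ++ d.2).

Definition prefixes (c w : cell) := prefix c.1 w.1 && prefix c.2 w.2.

(** [vertical] is the direction of the dividing line; [b] selects the right or
    the top half. *)
Definition half_cell (vertical b : bool) : cell :=
  if vertical then ([:: b], [::]) else ([::], [:: b]).

Definition deep N (w : cell) := (N <= size w.1)%N && (N <= size w.2)%N.

(** Lists of cells are taken up to permutation, so that the cell to be divided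
    can be brought to the front and no membership condition is needed. *)
Inductive cell_pattern : seq cell -> Prop :=
| cell_pattern_unit : cell_pattern [:: unit_cell]
| cell_pattern_split vertical c s : cell_pattern (c :: s) ->
    cell_pattern [:: subcell c (half_cell vertical false),
                     subcell c (half_cell vertical true) & s]
| cell_pattern_perm s t : perm_eq s t -> cell_pattern s -> cell_pattern t.

(** The partitions of the square by cells, with sufficiently deep cells in the
    role of points. *)
Definition exact_cover (s : seq cell) :=
  exists N, forall w, deep N w -> count (prefixes^~ w) s = 1%N.

Lemma subcell1c c : subcell unit_cell c = c. Proof. by case: c. Qed.

Lemma subcellc1 c : subcell c unit_cell = c.
Proof. by case: c => u v; rewrite /subcell /= !cats0. Qed.

Lemma subcellA c d e : subcell c (subcell d e) = subcell (subcell c d) e.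
Proof. by rewrite /subcell /= !catA. Qed.

Lemma subcell_inj c : injective (subcell c).
Proof.
move=> [u v] [u' v'] [/eqP + /eqP].
by rewrite !eqseq_cat // !eqxx => /eqP -> /eqP ->.
Qed.

Lemma prefixesP c w : reflect (exists d, w = subcell c d) (prefixes c w).
Proof.
apply: (iffP andP) => [[/prefixP[u wu] /prefixP[v wv]]|[d ->]].
  by exists (u, v); case: w wu wv => ? ? /= -> ->.
by rewrite /= !prefix_prefix.
Qed.

Lemma prefixes_subcell c d w :
  prefixes (subcell c d) (subcell c w) = prefixes d w.
Proof.
apply/prefixesP/prefixesP => [] [e].
  by rewrite -subcellA => /subcell_inj ->; exists e.
by move=> ->; exists e; rewrite subcellA.
Qed.

Lemma deepW M N w : (M <= N)%N -> deep N w -> deep M w.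
Proof. by move=> MN /andP[? ?]; apply/andP; split; apply: leq_trans MN _. Qed.

Lemma deep_subcell N c w : deep N w -> deep N (subcell c w).
Proof.
by move=> /andP[w1 w2]; rewrite /deep /= !size_cat !(leq_trans _ (leq_addl _ _)).
Qed.

Lemma depth_bound (s : seq cell) :
  exists N, forall c, c \in s -> (size c.1 <= N)%N && (size c.2 <= N)%N.
Proof.
exists (\max_(c <- s) maxn (size c.1) (size c.2)) => c cs.
by rewrite -geq_max (@leq_bigmax_seq _ _ _ (fun c => maxn _ _) _ cs).
Qed.

(** A cell that is strictly deeper than [c] in both directions and lies in [c]
    lies in exactly one half of it, whichever way [c] is divided. *)
Lemma prefixes_split vertical c w : (size c.1 < size w.1)%N -> (size c.2 < size w.2)%N ->
  (prefixes (subcell c (half_cell vertical false)) w +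
   prefixes (subcell c (half_cell vertical true)) w = prefixes c w)%N.
Proof.
case: (boolP (prefixes c w)) => [/prefixesP[d ->]|cw]; last first.
  have no b : prefixes (subcell c (half_cell vertical b)) w = false.
    apply/negP => /prefixesP[d wE]; case/prefixesP: cw.
    by exists (subcell (half_cell vertical b) d); rewrite subcellA.
  by rewrite !no.
rewrite !prefixes_subcell /= !size_cat -!ltn_subLR // ?subnn ?size_ge0.
case: d => [[|x u] [|y v]] // _ _.
case: vertical; rewrite /prefixes /= ?prefix0s ?andbT.
  by case: x.
by case: y.
Qed.

Lemma cell_pattern_exact_cover s : cell_pattern s -> exact_cover s.
Proof.
elim=> [|vertical c {}s _ [N cover]|{}s t st _ [N cover]].
- by exists 0 => w _ /=; rewrite /prefixes /= !prefix0s.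
- exists (maxn N (maxn (size c.1) (size c.2)).+1) => w dw /=.
  rewrite addnA prefixes_split -?(cover w) //.
  + by apply: deepW dw; rewrite leq_maxl.
  + by case/andP: dw; rewrite geq_max => /andP[_ /(leq_trans _)-> //];
      rewrite ltnS leq_maxl.
  + by case/andP: dw => _; rewrite geq_max => /andP[_ /(leq_trans _)-> //];
      rewrite ltnS leq_maxr.
- by exists N => w /cover <-; apply/esym/seq.permP.
Qed.

(** Exact covers speak of deep cells only; padding with zeros gives a deep cell
    inside any given one. *)
Lemma deep_extension N (c : cell) : deep N (subcell c (nseq N false, nseq N false)).
Proof. by apply: deep_subcell; rewrite /deep /= size_nseq leqnn. Qed.

Lemma count_le1_eq (T : eqType) (p : pred T) (s : seq T) x y :
  count p s = 1%N -> x \in s -> y \in s -> p x -> p y -> x = y.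
Proof.
move=> ps1 xs ys px py.
have: size (seq.filter p s) = 1%N by rewrite size_filter.
have: x \in seq.filter p s by rewrite mem_filter px.
have: y \in seq.filter p s by rewrite mem_filter py.
by case: (seq.filter p s) => [|z []] //; rewrite !inE => /eqP-> /eqP->.
Qed.

Lemma exact_cover_uniq s : exact_cover s -> uniq s.
Proof.
move=> [N cover]; apply: count_mem_uniq => c.
have [cs|/count_memPn//] := boolP (c \in s); apply/eqP.
rewrite eqn_leq /= -has_count has_pred1 cs andbT -(cover _ (deep_extension N c)).
by apply: sub_count => d /eqP ->; apply/prefixesP; eexists.
Qed.

(** The unit cell contains all others, hence leaves no room for them. *)
Lemma exact_cover_unit s : exact_cover s -> unit_cell \in s -> s = [:: unit_cell].
Proof.
move=> s_cover us; have [N cover] := s_cover.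
apply: perm_small_eq => //; apply: uniq_perm => //; first exact: exact_cover_uniq.
move=> c; rewrite inE; apply/idP/eqP => [cs|-> //].
apply: (count_le1_eq (cover _ (deep_extension N c))) => //.
  by apply/prefixesP; eexists.
by rewrite /prefixes !prefix0s.
Qed.

(** The divisions that produce [s] from the unit square can be performed,
    rescaled, inside a member of another pattern. *)
Lemma cell_pattern_graft c s t :
  cell_pattern s -> cell_pattern (c :: t) -> cell_pattern (map (subcell c) s ++ t).
Proof.
move=> + ct; elim=> [|vertical d {}s _|{}s s' ss' _].
- by rewrite /= subcellc1.
- by rewrite /= !subcellA; apply: cell_pattern_split.
- by apply: cell_pattern_perm; rewrite perm_cat2r perm_map.
Qed.

Definition rest_cell vertical (c : cell) : cell :=
  if vertical then (behead c.1, c.2) else (c.1, behead c.2).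

(** The cells of [s] on one side of a median, rescaled to fill the unit square. *)
Definition half_part vertical b (s : seq cell) :=
  map (rest_cell vertical) (seq.filter (prefixes (half_cell vertical b)) s).

Lemma half_partK vertical b s :
  map (subcell (half_cell vertical b)) (half_part vertical b s) =
  seq.filter (prefixes (half_cell vertical b)) s.
Proof.
rewrite -map_comp -[RHS]map_id; apply/eq_in_map => c.
rewrite mem_filter => /andP[/prefixesP[[u v] ->] _] /=.
by case: vertical.
Qed.

Lemma exact_cover_half vertical b s : exact_cover s ->
  (forall c, c \in s -> prefixes (half_cell vertical false) c ||
                        prefixes (half_cell vertical true) c) ->
  exact_cover (half_part vertical b s).
Proof.
move=> [N cover] halves; exists N => w dw.
rewrite -(cover _ (deep_subcell (half_cell vertical b) dw)).
transitivity (count (prefixes^~ (subcell (half_cell vertical b) w))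
    (map (subcell (half_cell vertical b)) (half_part vertical b s))).
  by rewrite [RHS]count_map; apply: eq_count => c /=; rewrite prefixes_subcell.
rewrite half_partK count_filter; apply: eq_in_count => c /halves /=.
case: (boolP (prefixes c _)) => //= /prefixesP[d].
by case: vertical {halves} b c d => [] [] [[|[] ?] [|[] ?]] [[|[] ?] [|[] ?]] //=;
  rewrite /prefixes /= ?prefix0s.
Qed.

Definition total_length (s : seq cell) := (\sum_(c <- s) (size c.1 + size c.2))%N.

Lemma total_length_half vertical b s : s != [::] ->
  (forall c, c \in s -> prefixes (half_cell vertical false) c ||
                        prefixes (half_cell vertical true) c) ->
  (total_length (half_part vertical b s) < total_length s)%N.
Proof.
move=> s0 halves.
rewrite /total_length big_map big_filter big_mkcond /= [in ltnRHS]big_seq big_seq.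
case: s s0 halves => // c s _ halves.
have lt d : d \in c :: s ->
  ((if prefixes (half_cell vertical b) d
   then size (rest_cell vertical d).1 + size (rest_cell vertical d).2 else 0) <
   size d.1 + size d.2)%N.
  move=> /halves; case: vertical {halves} b d => [] [] [[|[] ?] [|[] ?]] //=;
   by rewrite /prefixes /= ?prefix0s //= ?addnS.
rewrite -!big_seq !big_cons -addSn leq_add ?lt ?mem_head //.
rewrite big_seq [in leqRHS]big_seq.
by apply: leq_sum => d ds; rewrite ltnW // lt // in_cons ds orbT.
Qed.

(** A cell of full height and a cell of full width cross, and the members of an
    exact cover that have a common deep subcell are equal: both would be the unit
    cell.  So one of the two medians cuts no member. *)
Lemma exact_cover_halves s : exact_cover s -> unit_cell \notin s ->
  exists vertical, forall c, c \in s -> prefixes (half_cell vertical false) c ||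
                                  prefixes (half_cell vertical true) c.
Proof.
move=> [N cover] us.
have halvesP vertical c : ~~ (prefixes (half_cell vertical false) c ||
  prefixes (half_cell vertical true) c) = nilp (if vertical then c.1 else c.2).
  by case: vertical c => [] [[|[] ?] [|[] ?]]; rewrite /prefixes /= ?prefix0s.
have [/allP ?|/allPn[c cs]] := boolP (all (fun c =>
  prefixes (half_cell true false) c || prefixes (half_cell true true) c) s).
  by exists true.
rewrite halvesP => /nilP c1.
have [/allP ?|/allPn[d ds]] := boolP (all (fun c =>
  prefixes (half_cell false false) c || prefixes (half_cell false true) c) s).
  by exists false.
rewrite halvesP => /nilP d2.
have cd : c = d.
  (* c has full width and d has full height; they cross in (d.1, c.2) *)
  apply: (count_le1_eq (cover _ (deep_extension N (d.1, c.2)))) => //.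
    by rewrite /prefixes /= c1 prefix0s prefix_prefix.
  by rewrite /prefixes /= d2 prefix0s prefix_prefix.
suff: c = unit_cell by move=> e; rewrite e (negPf us) in cs.
by move: c1; rewrite cd in cs *; case: (d) d2 => /= ? ? -> ->.
Qed.

(** Induction along the uncut median of [exact_cover_halves]: both sides are exact
    covers with shorter words, hence patterns, and they are grafted on the two
    halves of the unit square.  This is special to dimension 2: in the cube there
    are dyadic partitions that no median plane leaves uncut. *)
Lemma exact_cover_cell_pattern s : exact_cover s -> cell_pattern s.
Proof.
have [n] := ubnP (total_length s); elim: n s => // n IH s sn s_cover.
have [us|us] := boolP (unit_cell \in s).
  by rewrite (exact_cover_unit s_cover us); exact: cell_pattern_unit.
have [vertical halves] := exact_cover_halves s_cover us.
have s0 : s != [::].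
  by case: s_cover => N /(_ _ (deep_extension N unit_cell)); case: (s).
have part b : cell_pattern (half_part vertical b s).
  apply: IH; last exact: exact_cover_half.
  by rewrite (leq_trans (total_length_half b s0 halves)).
have := cell_pattern_graft (part false) (cell_pattern_split vertical cell_pattern_unit).
rewrite !subcell1c half_partK => left_refined.
have /(cell_pattern_graft (part true)) : cell_pattern (half_cell vertical true ::
    seq.filter (prefixes (half_cell vertical false)) s).
  by apply: cell_pattern_perm left_refined; rewrite perm_catC.
rewrite half_partK; apply: cell_pattern_perm.
rewrite perm_sym -(perm_filterC (prefixes (half_cell vertical true))) perm_cat2l.
rewrite (@eq_in_filter _ (predC _) (prefixes (half_cell vertical false)))
  // => c /halves /=.
by case: vertical {halves part left_refined} c => [] [[|[] ?] [|[] ?]];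
  rewrite /prefixes /= ?prefix0s.
Qed.

Definition words N : seq (seq bool) := map val (enum {: N.-tuple bool}).

Lemma mem_words N u : (u \in words N) = (size u == N).
Proof.
apply/mapP/eqP => [[t _ ->]|<-]; first exact: size_tuple.
by exists (in_tuple u); rewrite ?mem_enum.
Qed.

Definition grid N : seq cell := [seq (u, v) | u <- words N, v <- words N].

Lemma mem_grid N c : (c \in grid N) = (size c.1 == N) && (size c.2 == N).
Proof.
rewrite -!mem_words; apply/allpairsP/andP => [[[u v] [? ? ->]] //|[? ?]].
by exists c; split => //; case: (c).
Qed.

Lemma grid_uniq N : uniq (grid N).
Proof.
have wu : uniq (words N) by rewrite map_inj_uniq ?enum_uniq //; exact: val_inj.
by apply: allpairs_uniq => // -[? ?] [? ?].
Qed.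

Lemma deep_grid N w : deep N w ->
  exists c d, c \in grid N /\ w = subcell c d.
Proof.
move=> /andP[w1 w2].
exists (take N w.1, take N w.2), (drop N w.1, drop N w.2).
rewrite mem_grid /= !size_takel // !eqxx; split=> //.
by rewrite /subcell /= !cat_take_drop; case: (w).
Qed.

Local Open Scope ring_scope.

(** * Dyadic and triadic expansions *)

Section Contraction.
Variable R : realType.
Implicit Types (k x y : R) (u v : seq bool).

(** The affine map of ratio [k ^- size u] onto the interval with address [u].
    Both bases of interest are instances: for [k = 2] these are the dyadic
    intervals, for [k = 3] the digits are 0 and 2 and the images of the Cantor
    set are its basic pieces. *)
Fixpoint shrink k u x : R :=
  if u is b :: u' then (shrink k u' x + b%:R * (k - 1)) / k else x.

Lemma shrink_cat k u v x :
  shrink k (u ++ v) x = shrink k u (shrink k v x).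
Proof. by elim: u => //= b u ->. Qed.

Lemma shrink_affine k u x :
  shrink k u x = shrink k u 0 + (k ^+ size u)^-1 * x.
Proof.
elim: u => [|b u IH] /=; first by rewrite expr0 invr1 mul1r add0r.
by rewrite IH exprS invfM; ring.
Qed.

Lemma shrink_inj k u : 0 < k -> injective (shrink k u).
Proof.
move=> k0 x y; rewrite (shrink_affine k u x) (shrink_affine k u y) => /addrI /mulfI; apply.
by rewrite invr_eq0 expf_neq0 ?gt_eqF.
Qed.

Lemma shrink_le k u x y : 0 < k -> (shrink k u x <= shrink k u y) = (x <= y).
Proof.
move=> k0; rewrite (shrink_affine k u x) (shrink_affine k u y) lerD2l ler_pM2l //.
by rewrite invr_gt0 exprn_gt0.
Qed.

Lemma shrink_mid k u :
  shrink k u (2^-1) = (shrink k u 0 + shrink k u 1) / 2.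
Proof. by rewrite (shrink_affine _ u 2^-1) (shrink_affine _ u 1); lra. Qed.

Lemma shrink2_itv u x : 0 < x < 1 -> 0 < shrink 2 u x < 1.
Proof.
move=> x01; elim: u => //= b u; move: (shrink _ _ _) => y y01.
by case: b => /=; lra.
Qed.

(** Endpoints are shared by many dyadic intervals, but the midpoint determines
    the interval: it lies in the interior of each interval containing it. *)
Lemma shrink2_mid_inj u v : shrink 2 u (2^-1) = shrink 2 v (2^-1) -> u = v.
Proof.
have half01 : 0 < (2^-1 : R) < 1 by lra.
elim: u v => [|b u IH] [|c v] //=.
- by have := shrink2_itv v half01; case: c => /= ? ?; exfalso; lra.
- by have := shrink2_itv u half01; case: b {IH} => /= ? ?; exfalso; lra.
- have := shrink2_itv u half01; have := shrink2_itv v half01 => mv mu e.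
  have bc : b = c by case: b c e {IH} => [] [] //= ?; exfalso; lra.
  by rewrite bc (IH v) //; move: e; rewrite bc; lra.
Qed.

Lemma cantor_set_itv x : cantor_set R x -> 0 <= x <= 1.
Proof. by move=> /(_ 0%N I) /=; rewrite in_itv. Qed.

Lemma iter_cantor_step_itv n x : iter n (@cantor_step R) `[0, 1]%classic x -> 0 <= x <= 1.
Proof.
elim: n x => [|n IH] x /=; first by rewrite in_itv.
by case=> -[y /IH y01 <-]; lra.
Qed.

Lemma cantor_set_step x (b : bool) :
  cantor_set R x -> cantor_set R ((x + b%:R * (3 - 1)) / 3).
Proof.
move=> Cx [_|n _].
  by have := cantor_set_itv Cx; rewrite /= in_itv; case: b => /=; lra.
rewrite iterS; case: b; [right|left]; exists x; rewrite ?Cx //=; try (exact: Cx); lra.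
Qed.

Lemma cantor_set_unstep x : cantor_set R x ->
  exists (b : bool) y, cantor_set R y /\ x = (y + b%:R * (3 - 1)) / 3.
Proof.
move=> Cx; have := cantor_set_itv Cx => x01.
have [x3|x3] := lerP x (1 / 3).
  exists false, (3 * x); split; last by rewrite mul0r addr0; lra.
  move=> n _; have [] := Cx n.+1 I => -[y yn yx].
    by rewrite (_ : 3 * x = y) //; lra.
  by have := iter_cantor_step_itv yn; lra.
exists true, (3 * x - 2); split; last by rewrite mul1r; lra.
move=> n _; have [] := Cx n.+1 I => -[y yn yx].
  by have := iter_cantor_step_itv yn; lra.
by rewrite (_ : 3 * x - 2 = y) //; lra.
Qed.

Lemma cantor_set0 : cantor_set R 0.
Proof.
move=> n _; elim: n => [|n IH] /=; first by rewrite in_itv /=; lra.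
by left; exists 0; rewrite ?mul0r.
Qed.

Lemma cantor_set1 : cantor_set R 1.
Proof.
move=> n _; elim: n => [|n IH] /=; first by rewrite in_itv /=; lra.
by right; exists 1 => //; lra.
Qed.

Lemma cantor_set_shrink u x : cantor_set R x -> cantor_set R (shrink 3 u x).
Proof. by move=> Cx; elim: u => //= b u; apply: cantor_set_step. Qed.

Lemma cantor_set_address N x : cantor_set R x ->
  exists u y, [/\ size u = N, cantor_set R y & x = shrink 3 u y].
Proof.
elim: N x => [|N IH] x Cx; first by exists [::], x.
have [b [y [/IH[u [z [<- Cz ->]] ->]]]] := cantor_set_unstep Cx.
by exists (b :: u), z.
Qed.

(** The gaps removed up to stage [N] have length at least [3 ^- N], so that close
    points of the Cantor set have the same first [N] digits. *)
Lemma cantor_set_close_address u v x y : cantor_set R x -> cantor_set R y ->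
  size u = size v ->
  `|shrink 3 u x - shrink 3 v y| < (3 ^+ size u)^-1 -> u = v.
Proof.
move=> Cx Cy; elim: u v => [|b u IH] [|c v] //= [uv].
have := cantor_set_itv (cantor_set_shrink u Cx).
have := cantor_set_itv (cantor_set_shrink v Cy).
have := IH _ uv.
set p := shrink 3 u x; set q := shrink 3 v y => puv q01 p01.
rewrite exprS invfM => near.
have small : (3 ^+ size u)^-1 <= 1 :> R.
  by rewrite invf_le1 ?exprn_gt0 // exprn_ege1 //; lra.
have bc : b = c.
  move: near; rewrite ltr_norml {IH uv puv}.
  by move: (_^-1) small => e small; case: b c => [] [] //= /andP[? ?]; exfalso; lra.
rewrite -bc puv //; move: near; rewrite -bc -mulrBl opprD addrACA subrr addr0.
rewrite normrM [`|3^-1|]ger0_norm ?invr_ge0 // mulrC ltr_pM2l ?invr_gt0 //.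
Qed.

Lemma cantor_set_prefix u v x y : cantor_set R x -> cantor_set R y ->
  (size v <= size u)%N -> shrink 3 u x = shrink 3 v y -> prefix v u.
Proof.
move=> Cx Cy vu; rewrite -{1}(cat_take_drop (size v) u) shrink_cat => e.
rewrite prefixE; apply/eqP.
apply: (cantor_set_close_address (cantor_set_shrink (drop (size v) u) Cx) Cy).
  by rewrite size_takel.
by rewrite e subrr normr0 invr_gt0 exprn_gt0.
Qed.

End Contraction.

(** * Rectangles and pieces named by cells *)

Section Cells.
Variable R : realType.
Implicit Types (u v : seq bool) (c d : cell) (r : rect R).

Definition cell_rect c : rect R :=
  Rect (shrink 2 c.1 0) (shrink 2 c.1 1) (shrink 2 c.2 0) (shrink 2 c.2 1).

Definition cell_map c (w : R * R) : R * R := (shrink 3 c.1 w.1, shrink 3 c.2 w.2).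

Definition cell_set c : set (R * R) := cell_map c @` cantor_square R.

(** This is what makes [piece] well defined: a rectangle remembers its two words,
    and only the order in which vertical and horizontal divisions alternated is
    lost. *)
Lemma cell_rect_inj : injective cell_rect.
Proof.
move=> [u v] [u' v'] [/= eu0 eu1 ev0 ev1]; congr pair; apply: (@shrink2_mid_inj R).
  by rewrite !shrink_mid eu0 eu1.
by rewrite !shrink_mid ev0 ev1.
Qed.

Lemma cell_map_subcell c d w : cell_map (subcell c d) w = cell_map c (cell_map d w).
Proof. by rewrite /cell_map /= !shrink_cat. Qed.

Lemma cantor_square_cell_map c w : cantor_square R w -> cantor_square R (cell_map c w).
Proof. by case=> ? ?; split; apply: cantor_set_shrink. Qed.

Lemma cantor_square0 : cantor_square R (0, 0).
Proof. by split; apply: cantor_set0. Qed.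

Lemma cell_map_inj c : injective (cell_map c).
Proof. by move=> [? ?] [? ?] [/shrink_inj-> // /shrink_inj-> //]. Qed.

Lemma cell_map_prefixes c d w w' : cantor_square R w -> cantor_square R w' ->
  (size d.1 <= size c.1)%N -> (size d.2 <= size c.2)%N ->
  cell_map c w = cell_map d w' -> prefixes d c.
Proof.
move=> [w1 w2] [w1' w2'] dc1 dc2 [e1 e2]; apply/andP; split.
  exact: cantor_set_prefix dc1 e1.
exact: cantor_set_prefix dc2 e2.
Qed.

Lemma cell_map_size_inj c d w w' : cantor_square R w -> cantor_square R w' ->
  size c.1 = size d.1 -> size c.2 = size d.2 -> cell_map c w = cell_map d w' -> c = d.
Proof.
have same u v x y : cantor_set R x -> cantor_set R y -> size u = size v ->
    shrink 3 u x = shrink 3 v y -> u = v.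
  move=> Cx Cy uv e; apply: (cantor_set_close_address Cx Cy uv).
  by rewrite e subrr normr0 invr_gt0 exprn_gt0.
case: c d => [u v] [u' v'] [Cw1 Cw2] [Cw1' Cw2'] /= su sv [/same-> // /same-> //].
Qed.

Lemma cell_map_grid_inj N c d w w' : cantor_square R w -> cantor_square R w' ->
  c \in grid N -> d \in grid N -> cell_map c w = cell_map d w' -> c = d.
Proof.
rewrite !mem_grid => Cw Cw' /andP[/eqP c1 /eqP c2] /andP[/eqP d1 /eqP d2].
by apply: cell_map_size_inj; rewrite ?c1 ?c2.
Qed.

Lemma cantor_square_grid N z : cantor_square R z ->
  exists c w, [/\ c \in grid N, cantor_square R w & z = cell_map c w].
Proof.
case: z => x y [/= Cx Cy].
have [u [x' [su Cx' ->]]] := cantor_set_address N Cx.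
have [v [y' [sv Cy' ->]]] := cantor_set_address N Cy.
by exists (u, v), (x', y'); rewrite mem_grid /= su sv eqxx.
Qed.

Definition half_rect (vertical b : bool) : rect R -> rect R :=
  if vertical then if b then @right_half R else @left_half R
  else if b then @top_half R else @bottom_half R.

Definition third_rect (vertical b : bool) : rect R -> rect R :=
  if vertical then if b then @right_third R else @left_third R
  else if b then @top_third R else @bottom_third R.

Lemma half_cell_rect vertical b c :
  half_rect vertical b (cell_rect c) = cell_rect (subcell c (half_cell vertical b)).
Proof.
have bit0 (t : bool) : shrink (2 : R) [:: t] 0 = if t then 2^-1 else 0 by case: t => /=; lra.
have bit1 (t : bool) : shrink (2 : R) [:: t] 1 = if t then 1 else 2^-1 by case: t => /=; lra.
by case: vertical b => [] []; rewrite /cell_rect /= ?cats0 !shrink_cat bit0 bit1 shrink_mid.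
Qed.

Lemma inf_min (A : set R) a : A a -> lbound A a -> inf A = a.
Proof.
move=> Aa lba; apply/eqP; rewrite eq_le lb_le_inf ?andbT //; last by exists a.
by apply: ge_inf => //; exists a.
Qed.

Lemma sup_max (A : set R) a : A a -> ubound A a -> sup A = a.
Proof.
move=> Aa uba; apply/eqP; rewrite eq_le ge_sup //=; last by exists a.
by apply: ub_le_sup => //; exists a.
Qed.

Lemma hull_cell_set c :
  hull (cell_set c) = Rect (shrink 3 c.1 0) (shrink 3 c.1 1)
                           (shrink 3 c.2 0) (shrink 3 c.2 1).
Proof.
have C0 := cantor_set0 R; have C1 := cantor_set1 R.
have corner x y : cantor_set R x -> cantor_set R y -> cell_set c (cell_map c (x, y)).
  by exists (x, y).
have itv x : cantor_set R x -> (0 <= x) /\ (x <= 1) by move/cantor_set_itv/andP.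
rewrite /hull; congr Rect; [apply: inf_min|apply: sup_max|apply: inf_min|apply: sup_max].
- by exists (cell_map c (0, 0)) => //; apply: corner.
- by move=> _ [_ [w [/itv[? _] _] <-] <-]; rewrite shrink_le.
- by exists (cell_map c (1, 0)) => //; apply: corner.
- by move=> _ [_ [w [/itv[_ ?] _] <-] <-]; rewrite shrink_le.
- by exists (cell_map c (0, 0)) => //; apply: corner.
- by move=> _ [_ [w [_ /itv[? _]] <-] <-]; rewrite shrink_le.
- by exists (cell_map c (0, 1)) => //; apply: corner.
- by move=> _ [_ [w [_ /itv[_ ?]] <-] <-]; rewrite shrink_le.
Qed.

Lemma shrink_cantor_itv u x : cantor_set R x ->
  shrink 3 u 0 <= shrink 3 u x <= shrink 3 u 1.
Proof. by move=> /cantor_set_itv; rewrite !shrink_le. Qed.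

Lemma shrink_left_third u b x : cantor_set R x ->
  (shrink 3 u (shrink 3 [:: b] x) <=
     shrink 3 u 0 + (shrink 3 u 1 - shrink 3 u 0) / 3) = ~~ b.
Proof.
move=> /cantor_set_itv x01.
rewrite (_ : _ + _ / 3 = shrink 3 u (1 / 3)); last first.
  by rewrite (shrink_affine _ u 1) (shrink_affine _ u (1 / 3)); lra.
by rewrite shrink_le //; case: b => /=; apply/idP; lra.
Qed.

Lemma shrink_right_third u b x : cantor_set R x ->
  (shrink 3 u 1 - (shrink 3 u 1 - shrink 3 u 0) / 3 <=
     shrink 3 u (shrink 3 [:: b] x)) = b.
Proof.
move=> /cantor_set_itv x01.
rewrite (_ : _ - _ / 3 = shrink 3 u (2 / 3)); last first.
  by rewrite (shrink_affine _ u 1) (shrink_affine _ u (2 / 3)); lra.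
by rewrite shrink_le //; case: b => /=; apply/idP; lra.
Qed.

(** A point of the piece of [c] lies in the closed third of its hull on the side
    [b] exactly when its next digit is [b]; the middle third separates the two
    cases. *)
Lemma in_third_rect vertical b c t w : cantor_square R w ->
  rect_set (third_rect vertical b (hull (cell_set c)))
    (cell_map c (cell_map (half_cell vertical t) w)) <-> t = b.
Proof.
move=> Cw; have Cz := cantor_square_cell_map (half_cell vertical t) Cw.
have /andP[x0 x1] := shrink_cantor_itv c.1 Cz.1.
have /andP[y0 y1] := shrink_cantor_itv c.2 Cz.2.
have {Cz} [Cx Cy] := Cw.
have Lx := shrink_left_third c.1 t Cx; have Rx := shrink_right_third c.1 t Cx.
have Ly := shrink_left_third c.2 t Cy; have Ry := shrink_right_third c.2 t Cy.
rewrite hull_cell_set; move: x0 x1 y0 y1 Lx Rx Ly Ry; rewrite /rect_set.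
case: vertical b => [] [] /= x0 x1 y0 y1 Lx Rx Ly Ry;
  rewrite !in_itv /= ?x0 ?x1 ?y0 ?y1 ?Lx ?Rx ?Ly ?Ry ?andbT;
  clear; split; case: t => // -[] //.
Qed.

Lemma cell_set_half vertical b c :
  cell_set c `&` rect_set (third_rect vertical b (hull (cell_set c))) =
  cell_set (subcell c (half_cell vertical b)).
Proof.
apply/seteqP; split => [_ [[w Cw <-]]|_ [w Cw <-]]; last first.
  rewrite cell_map_subcell; split; last exact/in_third_rect.
  by exists (cell_map (half_cell vertical b) w) => //; apply: cantor_square_cell_map.
have [t [w' [Cw' wE]]] :
    exists t w', cantor_square R w' /\ w = cell_map (half_cell vertical t) w'.
  case: w Cw => x y [/= Cx Cy]; case: vertical.
    have [t [x' [Cx' ->]]] := cantor_set_unstep Cx.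
    by exists t, (x', y).
  have [t [y' [Cy' ->]]] := cantor_set_unstep Cy.
  by exists t, (x, y').
rewrite wE => /in_third_rect -/(_ Cw') <-.
by exists w' => //; rewrite cell_map_subcell.
Qed.

Lemma cell_rect1 : cell_rect unit_cell = unit_square R. Proof. by []. Qed.

Lemma cell_set1 : cell_set unit_cell = cantor_square R.
Proof. by rewrite /cell_set -[RHS]image_id; apply: eq_imagel => -[]. Qed.

Lemma is_piece_half vertical b r S : is_piece r S ->
  is_piece (half_rect vertical b r) (S `&` rect_set (third_rect vertical b (hull S))).
Proof.
by case: vertical b => [] [] ?;
  [apply: piece_right|apply: piece_left|apply: piece_top|apply: piece_bottom].
Qed.

Lemma is_piece_half_cell vertical b c : is_piece (cell_rect c) (cell_set c) ->
  is_piece (cell_rect (subcell c (half_cell vertical b)))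
           (cell_set (subcell c (half_cell vertical b))).
Proof. by rewrite -half_cell_rect -cell_set_half; apply: is_piece_half. Qed.

Lemma is_piece_cell c : is_piece (cell_rect c) (cell_set c).
Proof.
case: c => u v; elim/last_ind: v => [|v b IH].
  elim/last_ind: u => [|u b IH]; first by rewrite cell_rect1 cell_set1; apply: piece_unit.
  by have := is_piece_half_cell true b IH; rewrite /subcell /= cats1.
by have := is_piece_half_cell false b IH; rewrite /subcell /= cats1 cats0.
Qed.

Lemma is_pieceP r S : is_piece r S -> exists2 c, r = cell_rect c & S = cell_set c.
Proof.
elim=> [|{}r {}S _ [c -> ->]|{}r {}S _ [c -> ->]|{}r {}S _ [c -> ->]|{}r {}S _ [c -> ->]].
- by exists unit_cell; rewrite ?cell_set1.
- exists (subcell c (half_cell true false)); first by rewrite -half_cell_rect.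
  exact: (cell_set_half true false).
- exists (subcell c (half_cell true true)); first by rewrite -half_cell_rect.
  exact: (cell_set_half true true).
- exists (subcell c (half_cell false false)); first by rewrite -half_cell_rect.
  exact: (cell_set_half false false).
- exists (subcell c (half_cell false true)); first by rewrite -half_cell_rect.
  exact: (cell_set_half false true).
Qed.

Lemma piece_cell c : piece (cell_rect c) = cell_set c.
Proof.
apply: get_unique; first exact: is_piece_cell.
by move=> S /is_pieceP[d /cell_rect_inj -> ->].
Qed.

(** * Patterns named by lists of cells *)

(** The uniqueness hypothesis matters: dividing a rectangle removes it from the
    set of rectangles, hence removes all its occurrences in a list. *)
Lemma split_rects c c1 c2 s : uniq (c :: s) ->
  ((cell_rect @` [set` c :: s]) `\ cell_rect c) `|` [set cell_rect c1; cell_rect c2] =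
  cell_rect @` [set` [:: c1, c2 & s]].
Proof.
move=> /andP[cs _]; apply/seteqP; split=> [_ [[[d /= +] <- dc]|[->|->]]|_ [d /= + <-]].
- by rewrite inE => /predU1P[dE|ds]; [case: dc; rewrite dE|exists d; rewrite //= !inE ds !orbT].
- by exists c1; rewrite //= !inE eqxx.
- by exists c2; rewrite //= !inE eqxx orbT.
- rewrite !inE => /or3P[/eqP->|/eqP->|ds]; [by right; left|by right; right|left].
  split; first by exists d; rewrite //= inE ds orbT.
  by move=> /cell_rect_inj dc; rewrite -dc ds in cs.
Qed.

Lemma is_pattern_split vertical P r : is_pattern P -> P r ->
  is_pattern ((P `\ r) `|` [set half_rect vertical false r; half_rect vertical true r]).
Proof.
by case: vertical => ? ?; [apply: pattern_vertical|apply: pattern_horizontal].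
Qed.

Lemma cell_pattern_is_pattern s : cell_pattern s -> is_pattern (cell_rect @` [set` s]).
Proof.
elim=> [|vertical c {}s cs IH|{}s t st _ IH].
- rewrite (_ : _ @` _ = [set unit_square R]); first exact: pattern_unit.
  apply/seteqP; split=> [_ [c + <-]|_ ->]; first by rewrite /= inE => /eqP ->.
  by exists unit_cell; rewrite //= inE.
- rewrite -(@split_rects c).
    rewrite -!half_cell_rect; apply: is_pattern_split => //.
    by exists c; rewrite //= mem_head.
  exact: exact_cover_uniq (cell_pattern_exact_cover cs).
- by rewrite (_ : [set` t] = [set` s]) //; apply/eq_set => c; rewrite (perm_mem st).
Qed.

Lemma is_patternP P : is_pattern P ->
  exists2 s, cell_pattern s & P = cell_rect @` [set` s].
Proof.
have split vertical (Q : set (rect R)) r s :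
    cell_pattern s -> Q = cell_rect @` [set` s] -> Q r ->
  exists2 s', cell_pattern s' &
    (Q `\ r) `|` [set half_rect vertical false r; half_rect vertical true r] =
    cell_rect @` [set` s'].
  move=> s_pat QE; rewrite QE => -[c /= cs <-].
  have c_pat := cell_pattern_perm (perm_to_rem cs) s_pat.
  eexists; first exact: (cell_pattern_split vertical c_pat).
  rewrite -(@split_rects c) ?half_cell_rect; last first.
    exact: exact_cover_uniq (cell_pattern_exact_cover c_pat).
  by rewrite (_ : [set` s] = [set` c :: rem c s]) //; apply/eq_set => d;
    rewrite (perm_mem (perm_to_rem cs)).
elim=> [|{}P r _ [s s_pat PE] Pr|{}P r _ [s s_pat PE] Pr].
- exists [:: unit_cell]; first exact: cell_pattern_unit.
  apply/seteqP; split=> [_ ->|_ [c + <-]]; last by rewrite /= inE => /eqP ->.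
  by exists unit_cell; rewrite //= inE.
- exact: (split true _ _ _ s_pat PE Pr).
- exact: (split false _ _ _ s_pat PE Pr).
Qed.

Lemma numbered_cell_pattern n s : cell_pattern s -> size s = n ->
  exists P : numbered_pattern R n, forall i, P i = cell_rect (nth unit_cell s i).
Proof.
move=> s_pat sn.
have bij : set_bij [set: 'I_n] (cell_rect @` [set` s])
    (fun i => cell_rect (nth unit_cell s i)).
  split=> [i _|i j _ _ /cell_rect_inj|_ [c /= cs <-]].
  - by exists (nth unit_cell s i) => //; rewrite /= mem_nth ?sn.
  - move=> /eqP; rewrite nth_uniq ?sn // => [/eqP/val_inj//|].
    exact: exact_cover_uniq (cell_pattern_exact_cover s_pat).
  - have ic : (index c s < n)%N by rewrite -sn index_mem.
    by exists (Ordinal ic); rewrite //= nth_index.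
by exists (NumberedPattern (cell_pattern_is_pattern s_pat) bij).
Qed.
End Cells.

(** * Prefix replacements *)

Section Carries.
Variable R : realType.
Local Notation C2 := (cantor_square R).
Implicit Types (c d : cell) (N : nat).

(** Stated through points [cell_map c w] of the cell, so that no inverse of
    [cell_map c] is needed. *)
Definition carries (f : C2 -> C2) c d := forall w, C2 w ->
  forall z : C2, \val z = cell_map c w -> \val (f z) = cell_map d w.

Definition carries_grid N (f : C2 -> C2) :=
  forall c, c \in grid N -> exists d, carries f c d.

Lemma cantor_point p : C2 p -> exists z : C2, \val z = p.
Proof. by move=> Cp; exists (SigSub (mem_set Cp)). Qed.

Lemma carries_subcell f c d e :
  carries f c d -> carries f (subcell c e) (subcell d e).
Proof.
move=> fcd w Cw z; rewrite !cell_map_subcell.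
by apply: fcd; apply: cantor_square_cell_map.
Qed.

Lemma carries_comp f g c d e : carries g c d -> carries f d e -> carries (f \o g) c e.
Proof. by move=> gcd fde w Cw z zE; apply: (fde w Cw); apply: gcd. Qed.

Lemma carries_cancel f g c d : cancel f g -> carries f c d -> carries g d c.
Proof.
move=> fK fcd w Cw z zE.
have [z' z'E] := cantor_point (cantor_square_cell_map c Cw).
rewrite -z'E -[z'](fK); congr (\val (g _)).
by apply: val_inj; rewrite /= zE (fcd w).
Qed.

Lemma carries_eq f g c d :
  carries f c d -> carries g c d ->
  forall z w, C2 w -> \val z = cell_map c w -> f z = g z.
Proof.
by move=> fcd gcd z w Cw zE; apply: val_inj; rewrite /= (fcd w) // (gcd w).
Qed.

Lemma cantor_point_grid N (z : C2) :
  exists c w, [/\ c \in grid N, C2 w & \val z = cell_map c w].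
Proof. exact/cantor_square_grid/set_valP. Qed.

(** An increasing affine map between two pieces of the Cantor set sends the least
    point to the least point and the greatest to the greatest, hence is determined
    by the pieces. *)
Lemma affine_image_shrink (a b : R) v : 0 < b ->
  (forall x, cantor_set R x -> exists2 y, cantor_set R y & a + b * x = shrink 3 v y) ->
  (forall y, cantor_set R y -> exists2 x, cantor_set R x & shrink 3 v y = a + b * x) ->
  forall x, a + b * x = shrink 3 v x.
Proof.
move=> b0 into onto x.
have itv y : cantor_set R y -> 0 <= y /\ y <= 1 by move=> /cantor_set_itv/andP.
have aE : a = shrink 3 v 0.
  apply/eqP; rewrite eq_le; apply/andP; split.
    have [y /itv[y0 _] ->] := onto _ (cantor_set0 R).
    by rewrite lerDl mulr_ge0 // ltW.
  have [y /itv[y0 _]] := into _ (cantor_set0 R).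
  by rewrite mulr0 addr0 => ->; rewrite shrink_le.
have abE : a + b = shrink 3 v 1.
  apply/eqP; rewrite eq_le; apply/andP; split.
    have [y /itv[_ y1]] := into _ (cantor_set1 R).
    by rewrite mulr1 => ->; rewrite shrink_le.
  have [y /itv[_ y1] ->] := onto _ (cantor_set1 R).
  by rewrite lerD2l ger_pMr.
by move: abE; rewrite shrink_affine (shrink_affine _ v x) -aE mulr1 => /addrI ->.
Qed.

(** Because of the rigidity of [affine_image_shrink], the affine map between two
    pieces that is allowed in 2V is the one that exchanges the prefixes. *)
Lemma carriesP (f : C2 -> C2) c d :
  (exists (a b : R) (j k : int),
     triadic_affine a b j k @` cell_set c = cell_set d /\
     forall z : C2, cell_set c (\val z) -> \val (f z) = triadic_affine a b j k (\val z))
  <-> carries f c d.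
Proof.
split=> [[a [b [j [k [image_cd fE]]]]]|fcd].
  move=> w Cw z zE; rewrite fE ?zE; last by exists w.
  have into x y : cantor_set R x -> cantor_set R y -> exists2 w', C2 w' &
      triadic_affine a b j k (cell_map c (x, y)) = cell_map d w'.
    move=> Cx Cy; have : cell_set d (triadic_affine a b j k (cell_map c (x, y))).
      by rewrite -image_cd; exists (cell_map c (x, y)) => //; exists (x, y).
    by case=> w' ? <-; exists w'.
  have onto x y : cantor_set R x -> cantor_set R y -> exists2 w', C2 w' &
      cell_map d (x, y) = triadic_affine a b j k (cell_map c w').
    move=> Cx Cy; have : cell_set d (cell_map d (x, y)) by exists (x, y).
    by rewrite -image_cd => -[_ [w' ? <-] <-]; exists w'.
  have C0 := cantor_set0 R.
  have pos (i : int) n : 0 < 3 ^ i * (3 ^+ n)^-1 :> R.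
    by rewrite mulr_gt0 ?exprz_gt0 ?invr_gt0 ?exprn_gt0.
  have regroup (a' : R) (i : int) u x : a' + 3 ^ i * shrink 3 u x =
      (a' + 3 ^ i * shrink 3 u 0) + (3 ^ i * (3 ^+ size u)^-1) * x.
    by rewrite (shrink_affine _ u x) mulrDr addrA mulrA.
  rewrite /triadic_affine /cell_map /=; congr pair; rewrite regroup.
    apply: affine_image_shrink => // x Cx.
      by have [w' [? _] [+ _]] := into _ _ Cx C0; rewrite regroup => ->; exists w'.1.
    by have [w' [? _] [-> _]] := onto _ _ Cx C0; rewrite regroup; exists w'.1.
  apply: affine_image_shrink => // x Cx.
    by have [w' [_ ?] [_ +]] := into _ _ C0 Cx; rewrite regroup => ->; exists w'.2.
  by have [w' [_ ?] [_ ->]] := onto _ _ C0 Cx; rewrite regroup; exists w'.2.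
(* the affine map that exchanges the prefixes has slope 3 ^ (|u| - |v|) *)
pose shift u v := shrink (3 : R) v 0 - 3 ^ ((size u)%:Z - (size v)%:Z) * shrink 3 u 0.
have shiftE u v x :
    shift u v + 3 ^ ((size u)%:Z - (size v)%:Z) * shrink 3 u x = shrink 3 v x.
  have ratio : 3 ^ ((size u)%:Z - (size v)%:Z) * (3 ^+ size u)^-1 = (3 ^+ size v)^-1 :> R.
    by rewrite expfzDr // -exprnN -exprnP mulrAC divff ?mul1r // expf_neq0.
  by rewrite (shrink_affine _ u x) (shrink_affine _ v x) /shift mulrDr addrA subrK mulrA ratio.
exists (shift c.1 d.1), (shift c.2 d.2),
  ((size c.1)%:Z - (size d.1)%:Z), ((size c.2)%:Z - (size d.2)%:Z).
have affE w : triadic_affine (shift c.1 d.1) (shift c.2 d.2)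
    ((size c.1)%:Z - (size d.1)%:Z) ((size c.2)%:Z - (size d.2)%:Z) (cell_map c w) =
    cell_map d w.
  by rewrite /triadic_affine /cell_map /= !shiftE.
split; last by move=> z [w Cw zE]; rewrite -zE affE; apply: fcd.
by rewrite /cell_set image_comp; apply: eq_imagel => w _; exact: affE.
Qed.

(** Images of distinct grid cells are disjoint, because [f] is injective. *)
Lemma carries_prefixes_inj N (f : self_homeo C2) c c' d d' w :
  c \in grid N -> c' \in grid N -> carries f c d -> carries f c' d' ->
  prefixes d w -> prefixes d' w -> c = c'.
Proof.
move=> cN c'N /(carries_cancel (@homeo_funK _ f)) fdc.
move=> /(carries_cancel (@homeo_funK _ f)) fdc' /prefixesP[e we] /prefixesP[e' we'].
have C0 x : C2 (cell_map x (0, 0)) by apply/cantor_square_cell_map/cantor_square0.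
have [z zE] := cantor_point (C0 w).
apply: (cell_map_grid_inj (C0 e) (C0 e') cN c'N).
transitivity (\val (homeo_inv f z)).
  by apply/esym/fdc => //; rewrite zE we cell_map_subcell.
by apply: fdc' => //; rewrite zE we' cell_map_subcell.
Qed.

(** The images of the grid cells cover, because [f] is surjective: a point of [w]
    is the image of a point of some grid cell [c], and [w] meets [g c] and is
    deeper than it. *)
Lemma carried_grid_covers N (f : self_homeo C2) (g : cell -> cell) :
  (forall c, c \in grid N -> carries f c (g c)) ->
  exists M, forall w, deep M w -> exists2 c, c \in grid N & prefixes (g c) w.
Proof.
move=> fg; have [M gM] := depth_bound (map g (grid N)).
exists M => w /andP[w1 w2].
have [z zE] := cantor_point (cantor_square_cell_map w (cantor_square0 R)).
have [c [y [cN Cy zcy]]] := cantor_point_grid N (homeo_inv f z).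
exists c => //; have /andP[gc1 gc2] := gM _ (map_f g cN).
apply: (cell_map_prefixes (cantor_square0 R) Cy).
- exact: leq_trans w1.
- exact: leq_trans w2.
- by rewrite -zE -(fg c cN y Cy _ zcy) homeo_invK.
Qed.

Lemma exact_cover_grid N : exact_cover (grid N).
Proof.
exists N => w /deep_grid[c [d [cN wE]]].
rewrite (@eq_in_count _ _ (pred1 c)) ?count_uniq_mem ?grid_uniq ?cN // => e eN /=.
apply/idP/eqP => [/prefixesP[e' wE']|->]; last by apply/prefixesP; exists d.
have C0 x : C2 (cell_map x (0, 0)) by apply/cantor_square_cell_map/cantor_square0.
by apply: (cell_map_grid_inj (C0 e') (C0 d) eN cN); rewrite -!cell_map_subcell -wE -wE'.
Qed.

Lemma exact_cover_carried_grid N (f : self_homeo C2) (g : cell -> cell) :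
  (forall c, c \in grid N -> carries f c (g c)) -> exact_cover (map g (grid N)).
Proof.
move=> fg; have [M covers] := carried_grid_covers fg.
exists M => w /covers[c cN gcw].
rewrite count_map (@eq_in_count _ _ (pred1 c)) ?count_uniq_mem ?grid_uniq ?cN //
  => e eN /=.
by apply/idP/eqP => [gew|-> //];
  apply: (carries_prefixes_inj eN cN (fg e eN) (fg c cN) gew gcw).
Qed.

Lemma carries_grid_choice N f : carries_grid N f ->
  exists g : cell -> cell, forall c, c \in grid N -> carries f c (g c).
Proof.
move=> fN; have /choice[g gP] : forall c, exists d, c \in grid N -> carries f c d.
  by move=> c; have [/fN[d] ?|] := boolP (c \in grid N); [exists d|exists c].
by exists g.
Qed.

(** Patterns disappear from the description of 2V.  From left to right, a grid
    finer than the first pattern will do.  From right to left, the grid and the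
    list of its images are exact covers, hence patterns, with the same number of
    members. *)
Lemma twoVP (f : self_homeo C2) : twoV R f <-> exists N, carries_grid N f.
Proof.
split=> [[n [P1 [P2 fP]]]|[N /carries_grid_choice[g fg]]].
  have cells (P : numbered_pattern R n) :
      exists2 s, cell_pattern s & np_set P = cell_rect R @` [set` s].
    exact: is_patternP (np_is_pattern P).
  have [s s_pat P1E] := cells P1; have [t _ P2E] := cells P2.
  have [N cover] := cell_pattern_exact_cover s_pat.
  exists N => c; rewrite mem_grid => /andP[/eqP c1 /eqP c2].
  have : has (prefixes^~ c) s by rewrite has_count cover // /deep c1 c2 leqnn.
  move=> /hasP[d ds /prefixesP[e ->]].
  have [into1 _ onto1] := np_bij P1; have [into2 _ _] := np_bij P2.
  have [i _ P1i] : ([set P1 i | i in [set: 'I_n]]) (cell_rect R d).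
    by apply: onto1; rewrite P1E; exists d.
  have [d' _ P2i] : (cell_rect R @` [set` t]) (P2 i) by rewrite -P2E; apply: into2.
  exists (subcell d' e); apply: carries_subcell; apply/carriesP.
  by have := fP i; rewrite P1i -P2i !piece_cell.
have grid_pat : cell_pattern (grid N) by apply/exact_cover_cell_pattern/exact_cover_grid.
have image_pat := exact_cover_cell_pattern (exact_cover_carried_grid fg).
have [P1 P1E] := numbered_cell_pattern R grid_pat erefl.
have [P2 P2E] := numbered_cell_pattern R image_pat (size_map _ _).
exists (size (grid N)), P1, P2 => i.
rewrite P1E P2E (nth_map unit_cell) // !piece_cell.
by apply/carriesP/fg; rewrite mem_nth.
Qed.

Lemma twoV1 : twoV R (1%g : self_homeo C2).
Proof. by apply/twoVP; exists 0%N => c _; exists c => w _ z. Qed.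

(** A cell of depth [M + N] is a cell of depth [M] followed by [N] more digits.
    After [g] has replaced its prefix these digits are still there, so that the
    result is deep enough for [f]. *)
Lemma twoVM (f g : self_homeo C2) : twoV R f -> twoV R g -> twoV R (f * g)%g.
Proof.
move=> /twoVP[N fN] /twoVP[M gM]; apply/twoVP; exists (M + N)%N => c.
rewrite mem_grid => /andP[/eqP c1 /eqP c2].
have [c' [e [c'M ce]]] : exists c' e, c' \in grid M /\ c = subcell c' e.
  by apply: deep_grid; rewrite /deep c1 c2 leq_addr.
have [d gcd] := gM c' c'M.
have de_deep : deep N (subcell d e).
  apply: deep_subcell; move: c1 c2; rewrite ce /deep /= !size_cat.
  by move: c'M; rewrite mem_grid => /andP[/eqP-> /eqP->] /addnI-> /addnI->; rewrite leqnn.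
have [d' [e' [d'N deE]]] := deep_grid de_deep.
have [d'' fd] := fN d' d'N.
exists (subcell d'' e'); rewrite ce; apply: (@carries_comp f g _ _ _ (carries_subcell gcd)).
by rewrite deE; apply: carries_subcell.
Qed.

(** The images of a grid under [f] are finitely many cells that cover; a grid
    deeper than all of them refines them, and on it the inverse puts the original
    prefixes back. *)
Lemma twoVV (f : self_homeo C2) : twoV R f -> twoV R (f^-1)%g.
Proof.
move=> /twoVP[N /carries_grid_choice[g fg]]; apply/twoVP.
have [M covers] := carried_grid_covers fg; exists M => c.
rewrite mem_grid => /andP[/eqP c1 /eqP c2].
have /covers[d dN /prefixesP[e ->]] : deep M c by rewrite /deep c1 c2 leqnn.
exists (subcell d e); apply: carries_subcell.
exact: carries_cancel (@homeo_funK _ f) (fg d dN).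
Qed.

Lemma twoV_group_closed : group_closed [in twoV R].
Proof.
split; first by rewrite inE; apply: twoV1.
by move=> f g; rewrite !inE => Vf Vg; apply/twoVM/twoVV.
Qed.

(** The finite list of replaced prefixes determines the homeomorphism, and there
    are countably many such lists. *)
Lemma countable_twoV : countable (twoV R).
Proof.
have code (f : self_homeo C2) : exists s : seq (cell * cell), twoV R f ->
    (forall p, p \in s -> carries f p.1 p.2) /\
    forall z : C2, exists p w, [/\ p \in s, C2 w & \val z = cell_map p.1 w].
  have [/twoVP[N /carries_grid_choice[g fg]]|Vf] := pselect (twoV R f);
    last by exists [::].
  exists [seq (c, g c) | c <- grid N] => _; split=> [p /mapP[c cN ->]|z]; first exact: fg.
  have [c [w [cN Cw zE]]] := cantor_point_grid N z.
  by exists (c, g c), w; split => //; apply: map_f.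
have {code} [s sP] := choice code.
apply/countable_injP; exists (choice.pickle \o s) => f g.
rewrite !inE => Vf Vg /= /(pcan_inj choice.pickleK) sfg.
have [fs cover] := sP f Vf; have [gs _] := sP g Vg.
apply: self_homeoP => z; have [p [w [ps Cw zE]]] := cover z.
apply: (carries_eq (fs p ps) _ Cw zE).
by apply: gs; rewrite -sfg.
Qed.

End Carries.

(** * Recoding the first digits *)

Section Homeo.
Variable R : realType.
Local Notation C2 := (cantor_square R).
Implicit Types (c d : cell) (N : nat) (u : seq bool).

Lemma triadic_affine_continuous (a b : R) j k : continuous (triadic_affine a b j k).
Proof.
case=> x y.
have affine_cts (c e : R) (p : R * R -> R) : {for (x, y), continuous p} ->
    {for (x, y), continuous (fun z => c + e * p z)}.
  by move=> p_cts; apply: cvgD; [exact: cvg_cst|apply: cvgM; [exact: cvg_cst|exact: p_cts]].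
by apply: (cvg_pair (affine_cts _ _ _ cvg_fst) (affine_cts _ _ _ cvg_snd)).
Qed.

(** Points close to [z] lie in the same grid cell as [z], and on that cell [f]
    is the restriction of an affine map. *)
Lemma carries_grid_continuous N (f : C2 -> C2) : carries_grid N f -> continuous f.
Proof.
move=> fN; apply: continuous_comp_initial => z.
have [c [w [cN Cw zE]]] := cantor_point_grid N z.
have [d fcd] := fN c cN; have [a [b [j [k [_ fE]]]]] := (carriesP f c d).2 fcd.
have zc : cell_set c (\val z) by exists w.
have val_cts : continuous (set_val : C2 -> R * R) by exact: initial_continuous.
have fz : (set_val \o f) z = triadic_affine a b j k (set_val z) := fE z zc.
rewrite /continuous_at fz.
apply: (@cvg_trans _ ((triadic_affine a b j k \o set_val) z' @[z' --> z])); last first.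
  exact: (continuous_comp (val_cts z) (@triadic_affine_continuous a b j k _)).
apply: (@near_eq_cvg _ _ (nbhs z) (nbhs_filter z)).
have e0 : 0 < (3 ^+ N)^-1 :> R by rewrite invr_gt0 exprn_gt0.
have close : \forall z' \near z, ball (\val z) (3 ^+ N)^-1 (\val z').
  by apply: val_cts; exact: nbhsx_ballx.
apply: filterS close => z' [near1 near2]; apply/esym/fE.
have [c' [w' [c'N Cw' z'E]]] := cantor_point_grid N z'.
suff -> : c = c' by exists w'.
move: cN c'N near1 near2; rewrite !mem_grid zE z'E /ball /=.
case: c c' {zE z'E zc fcd fE} => [u v] [u' v'] /= /andP[/eqP su /eqP sv]
  /andP[/eqP su' /eqP sv'] near1 near2.
congr pair; first by apply: cantor_set_close_address Cw.1 Cw'.1 _ _; rewrite su.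
by apply: cantor_set_close_address Cw.2 Cw'.2 _ _; rewrite sv.
Qed.

Lemma first_address N (z : C2) :
  exists u w, [/\ size u = N, C2 w & \val z = cell_map (u, [::]) w].
Proof.
have := set_valP z; case: (\val z) => x y [/= Cx Cy].
have [u [x' [su Cx' ->]]] := cantor_set_address N Cx.
by exists u, (x', y).
Qed.

(** On the first coordinate, [f] applies [p] to the word of the first [N] digits;
    the digits after them and the second coordinate stay as they are. *)
Definition recodes N (p : seq bool -> seq bool) (f : C2 -> C2) :=
  forall u, size u = N -> carries f (u, [::]) (p u, [::]).

(** A point has only one word of first [N] digits, which makes the recoded point
    well defined. *)
Lemma recodes_exists N p : exists f, recodes N p f.
Proof.
have image (z : C2) : exists z' : C2, forall u w, size u = N -> C2 w ->
    \val z = cell_map (u, [::]) w -> \val z' = cell_map (p u, [::]) w.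
  have [u [w [su Cw zE]]] := first_address N z.
  have [z' z'E] := cantor_point (cantor_square_cell_map (p u, [::]) Cw).
  exists z' => u' w' su' Cw'; rewrite zE z'E => e.
  have uu' : (u, [::]) = (u', [::]) :> cell.
    by apply: cell_map_size_inj Cw Cw' _ _ e; rewrite /= ?su'.
  by move: e; case: uu' => -> /cell_map_inj ->.
have [f fP] := choice image; exists f => u su w Cw z zE.
exact: fP zE.
Qed.

Lemma recodes_unique N p f g : recodes N p f -> recodes N p g -> f =1 g.
Proof.
move=> fp gp z; have [u [w [su Cw zE]]] := first_address N z.
exact: carries_eq (fp u su) (gp u su) _ _ Cw zE.
Qed.

Lemma recodes_comp N p q f g : (forall u, size (q u) = size u) ->
  recodes N p f -> recodes N q g -> recodes N (p \o q) (f \o g).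
Proof.
move=> sq fp gq u su; apply: carries_comp (gq u su) (fp _ _).
by rewrite sq.
Qed.

Lemma recodes_id N : recodes N id id.
Proof. by move=> u _ w _ z. Qed.

Lemma recodes_carries_grid N p f : recodes N p f -> carries_grid N f.
Proof.
move=> fp [u v]; rewrite mem_grid => /andP[/eqP su _].
exists (subcell (p u, [::]) ([::], v)).
rewrite (_ : (u, v) = subcell (u, [::]) ([::], v)); last by rewrite /subcell /= cats0.
exact: carries_subcell (fp u su).
Qed.

Lemma recodes_homeo N p q : (forall u, size (p u) = size u) ->
  (forall u, size (q u) = size u) -> cancel p q -> cancel q p ->
  exists f : self_homeo C2, recodes N p f.
Proof.
move=> sp sq pK qK; have [f fp] := recodes_exists N p; have [g gq] := recodes_exists N q.
have fK : cancel f g.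
  apply: (@recodes_unique N (q \o p)) (recodes_comp sp gq fp) _ => u su.
  by rewrite /= pK; apply: recodes_id.
have gK : cancel g f.
  apply: (@recodes_unique N (p \o q)) (recodes_comp sq fp gq) _ => u su.
  by rewrite /= qK; apply: recodes_id.
by exists (SelfHomeo fK gK (carries_grid_continuous (recodes_carries_grid fp))
  (carries_grid_continuous (recodes_carries_grid gq))).
Qed.

Section Cayley.
Variable gT : finGroupType.
Implicit Types x y g : gT.

(** Any injective code by binary words of constant length would do; the indicator
    of [g] along the enumeration of [gT] is one of length [#|gT|]. *)
Definition one_hot g : seq bool := [seq h == g | h <- enum gT].

(** Left translation by [x], read on codes, and extended by the identity to the
    words that are not codes. *)
Definition cayley x u : seq bool :=
  if [pick g | one_hot g == u] is Some g then one_hot (x * g)%g else u.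

Lemma one_hot_inj : injective one_hot.
Proof.
move=> g h /eq_in_map/(_ g); rewrite mem_enum eqxx => /(_ isT)/esym/eqP //.
Qed.

Lemma cayley_one_hot x g : cayley x (one_hot g) = one_hot (x * g)%g.
Proof.
rewrite /cayley; case: pickP => [h /eqP/one_hot_inj -> //|/(_ g)].
by rewrite eqxx.
Qed.

Lemma size_cayley x u : size (cayley x u) = size u.
Proof. by rewrite /cayley; case: pickP => // g /eqP <-; rewrite !size_map. Qed.

Lemma cayley1 u : cayley 1%g u = u.
Proof. by rewrite /cayley; case: pickP => // g /eqP <-; rewrite mul1g. Qed.

Lemma cayleyM x y u : cayley (x * y)%g u = cayley x (cayley y u).
Proof.
rewrite {1 3}/cayley; case: pickP => [g _|no]; first by rewrite cayley_one_hot mulgA.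
by rewrite /cayley; case: pickP => // g; rewrite no.
Qed.

(** The left regular representation on codes.  Recodings are determined by their
    effect on words, so that the group law on words passes to homeomorphisms;
    [x] is recovered from its homeomorphism as the decoded image of the code
    of 1. *)
Lemma finite_group_embeds : exists phi : {multiplicative gT -> self_homeo C2},
  injective phi /\ forall x : gT, twoV R (phi x).
Proof.
have /choice[phi phiP] : forall x, exists f : self_homeo C2, recodes #|gT| (cayley x) f.
  move=> x; apply: (@recodes_homeo _ _ (cayley x^-1)%g) => u; rewrite ?size_cayley //.
    by rewrite -cayleyM mulVg cayley1.
  by rewrite -cayleyM mulgV cayley1.
have phiM : {morph phi : x y / (x * y)%g}.
  move=> x y; apply/self_homeoP/(recodes_unique (phiP _)).
  rewrite (_ : cayley (x * y) = cayley x \o cayley y); last exact/funext/cayleyM.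
  exact: recodes_comp (size_cayley y) (phiP x) (phiP y).
pose phi_mul := isMultiplicative.Build gT (self_homeo C2) phi phiM.
pose Phi : {multiplicative gT -> self_homeo C2} := HB.pack phi phi_mul.
exists Phi; split=> [x y /= phixy|x]; last first.
  by apply/twoVP; exists #|gT|; apply: recodes_carries_grid (phiP x).
have size1 : size (one_hot 1%g) = #|gT| by rewrite size_map -cardE.
have C0 := cantor_square0 R.
have [z zE] := cantor_point (cantor_square_cell_map (one_hot 1%g, [::]) C0).
have := phiP x _ size1 _ C0 z zE; rewrite phixy (phiP y _ size1 _ C0 z zE).
rewrite !cayley_one_hot !mulg1 => e.
have [] : (one_hot y, [::]) = (one_hot x, [::]) :> cell.
  by apply: (cell_map_size_inj C0 C0 _ _ e); rewrite //= !size_map.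
by move/one_hot_inj.
Qed.
End Cayley.

(** A finite 2V could not contain cyclic groups of all orders. *)
Lemma infinite_twoV : infinite_set (twoV R).
Proof.
move=> /finite_setP[n Vn]; have [phi [phi_inj phiV]] := finite_group_embeds 'I_n.+1.
have : (`I_n.+1 #<= `I_n)%card.
  rewrite -(card_le_eqr Vn) (card_le_eql card_II).
  rewrite -(card_le_eql (inj_card_eq (in2W phi_inj))).
  by apply/subset_card_le => _ [x _ <-]; apply: phiV.

by rewrite card_le_II ltnn.
Qed.

End Homeo.

Theorem lemma2p1 (R : realType) :
  [/\ group_closed [in twoV R],
      (twoV R #= [set: nat])%card &
      forall gT : finGroupType,
        exists phi : {multiplicative gT -> self_homeo (cantor_square R)},
          injective phi /\ forall x : gT, twoV R (phi x)].
Proof.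
split; [exact: twoV_group_closed|exact/eq_card_nat/infinite_twoV/countable_twoV|].
exact: finite_group_embeds.
Qed.
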